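(* There exist $s_0,n_0\in\mathbb{N}$ such that for all integers $s\geq s_0$, there exist an integer $n\geq n_0$ divisible by $s$ and a balanced bipartite graph $G[U,V]$ on $2n$ vertices with $\delta_U+\delta_V\geq n+s^{s^{1/3}}$ such that $G$ cannot be tiled with $K_{s,s}$.
   Context: $G[U,V]$ denotes a bipartite graph with vertex classes (parts) $U$ and $V$; it is balanced if $|U|=|V|$. For such a graph, $\delta_U:=\min\{\deg(u):u\in U\}$ and $\delta_V:=\min\{\deg(v):v\in V\}$. A balanced bipartite graph $G$ on $2n=2ms$ vertices can be tiled with $K_{s,s}$ if $G$ contains $m$ pairwise vertex-disjoint copies of the complete bipartite graph $K_{s,s}$ as (not necessarily induced) subgraphs, i.e. copies covering all vertices of $G$. *)

(* Defs.v *)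
From mathcomp Require Import all_boot all_order all_algebra.
From mathcomp Require Import reals exp.

Set Implicit Arguments.
Unset Strict Implicit.
Unset Printing Implicit Defensive.

Record sgraph := SGraph {
  vertex :> finType;
  edge : rel vertex;
  edge_sym : symmetric edge;
  edge_irrefl : irreflexive edge }.

Definition deg (G : sgraph) (x : G) : nat := #|[set y | edge x y]|.

(* Every degree is at most #|G|, so this default value does not affect the
   minimum over a nonempty A. *)
Definition min_deg (G : sgraph) (A : {set G}) : nat :=
  \big[minn/#|G|]_(x in A) deg x.

(* The two classes are not required to be nonempty. *)
Definition bipartition (G : sgraph) (U V : {set G}) : Prop :=
  [/\ U :|: V = [set: G], [disjoint U & V],
      {in U &, forall x y, ~~ edge x y} &
      {in V &, forall x y, ~~ edge x y}].

Definition balanced (G : sgraph) (U V : {set G}) : Prop := #|U| = #|V|.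

Section CompleteBipartite.
Variables s t : nat.

Definition cbip_edge : rel ('I_s + 'I_t)%type := fun x y =>
  match x, y with
  | inl _, inr _ | inr _, inl _ => true
  | _, _ => false
  end.

Lemma cbip_edge_sym : symmetric cbip_edge.
Proof. by case=> ? []. Qed.

Lemma cbip_edge_irrefl : irreflexive cbip_edge.
Proof. by case. Qed.

Definition complete_bipartite : sgraph :=
  SGraph cbip_edge_sym cbip_edge_irrefl.

End CompleteBipartite.

Notation "''K_' ( s , t )" := (complete_bipartite s t)
  (at level 8, format "''K_' ( s ,  t )").

(* A (not necessarily induced) copy of H in G. *)
Definition is_copy (H G : sgraph) (f : H -> G) : Prop :=
  injective f /\ {homo f : x y / edge x y}.

(* The cardinality condition makes m disjoint copies cover all of G. *)
Definition can_be_tiled (G : sgraph) (s : nat) : Prop :=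
  exists m : nat, #|G| = 2 * (m * s) /\
  exists f : 'I_m -> 'K_(s, s) -> G,
    (forall i, is_copy (f i)) /\
    (forall i j, i != j -> [disjoint codom (f i) & codom (f j)]).

(* Main.v *)
Require Import Defs.
From mathcomp Require Import all_boot all_order all_algebra.
From mathcomp Require Import reals exp.
From mathcomp Require Import zify lra.

(** Asymmetric degrees leave room for an obstruction that symmetric degrees
    exclude: a small set [K] of vertices of [U] may have all its neighbours in
    a small set [V0] of vertices of [V], while every other vertex of [U] is
    joined to all of [V]. If [K] has [k] vertices, each with [d] neighbours
    in [V0], then the minimum degrees are at least [d] and [n - k], with sum
    [n + (d - k)].

    A copy of K_{s,s} that meets [K] must place one whole side, [s] vertices,
    inside [V0]. If the graph between [K] and [V0] has no complete bipartite
    subgraph with [t] vertices in [K] and [s] in [V0], then such a copy covers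
    at most [t - 1] vertices of [K], so covering [K] uses at least
    [s k / (t - 1)] vertices of [V0]. This is [tiling_bound], and a tiling is
    impossible as soon as [#|V0| < s k / (t - 1)].

    It remains to find a bipartite graph of density larger than [(t - 1) / s]
    without K_{t,s} and with [k] very large. A random graph of density 1/2
    works. To make all degrees of [K] exactly one half of [#|V0|], so that no
    concentration estimate is needed, take [V0 = W * bool] and let each [u]
    in [K] choose, independently for each [w], one of [(w, false)] and
    [(w, true)] as a neighbour. The union bound over the [k ^ t * #|V0| ^ s]
    candidates for K_{t,s} is [exists_biclique_free_halving].

    The parameters are [a = s %/ 8], [t = 2 a], [k = 2 ^ a] and
    [#|W| = 2 k]. Then [#|V0| = 4 k] is less than [s k / (t - 1)] because
    [4 (2 a - 1) < 8 a <= s]; the union bound succeeds because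
    [a t + (a + 2) s < t s]; and the degree sum exceeds [n] by
    [d - k = k = 2 ^ (s %/ 8)], which eventually dominates
    [s ^ (s ^ (1/3)) = exp (s ^ (1/3) * ln s)]. *)

Set Implicit Arguments.
Unset Strict Implicit.
Unset Printing Implicit Defensive.

(** * A dense bipartite graph without large bicliques *)

Lemma card_ffun_agree (A B : finType) (D : {set A}) (g : A -> B) :
  #|[set f : {ffun A -> B} | [forall x in D, f x == g x]]| = #|B| ^ #|~: D|.
Proof.
pose F x : pred B := if x \in D then pred1 (g x) else predT.
have -> : #|[set f : {ffun A -> B} | [forall x in D, f x == g x]]|
          = #|family F|.
  apply: eq_card => f; rewrite inE.
  apply/forall_inP/familyP => [agr x|fam x xD].
    by rewrite /F; case: ifP => // xD; rewrite inE agr.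
  by have := fam x; rewrite /F xD inE.
rewrite card_family foldrE big_map big_enum /=.
rewrite (bigID (mem D)) /= big1 ?mul1n => [|x xD]; last first.
  by rewrite /F xD card1.
rewrite (eq_bigr (fun=> #|B|)) => [|x /negbTE xD]; last by rewrite /F xD.
rewrite prod_nat_const; congr (_ ^ _).
by apply: eq_card => x; rewrite !inE.
Qed.

(** Union bound over the choices [f]. A candidate biclique with sides [T] and
    [S] fixes [f] on [t * s] pairs, hence survives for a fraction
    [2 ^- (t * s)] of the choices. Sides are enumerated as duplicate-free
    tuples, so that the number of candidates is at most a product of powers
    and no binomial coefficient has to be estimated. *)
Lemma exists_biclique_free_halving (K W : finType) (t s : nat) :
    0 < t -> #|K| ^ t * (2 * #|W|) ^ s < 2 ^ (t * s) ->
  exists f : {ffun K * W -> bool},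
    forall (T : {set K}) (S : {set W * bool}), t <= #|T| -> s <= #|S| ->
    exists u p, [/\ u \in T, p \in S & f (u, p.1) != p.2].
Proof.
move=> t_gt0 few.
pose cand : finType := (t.-tuple K * s.-tuple (W * bool))%type.
pose bad (c : cand) := [set f : {ffun K * W -> bool} |
  [forall u in c.1, forall p in c.2, f (u, p.1) == p.2]].
pose proper (c : cand) := uniq c.1 && uniq c.2.
have card_bad c : proper c -> #|bad c| * 2 ^ (t * s) <= 2 ^ (#|K| * #|W|).
  case: c => tau sigma /andP[/= Utau Usigma].
  have [->|[f0 f0_bad]] := set_0Vmem (bad (tau, sigma)).
    by rewrite cards0.
  have f0E u p : u \in tau -> p \in sigma -> f0 (u, p.1) = p.2.
    move=> uT pS; move: f0_bad; rewrite inE => /forall_inP/(_ u uT).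
    by move=> /forall_inP/(_ p pS)/eqP.
  have tau0 : tnth tau (Ordinal t_gt0) \in tau by exact: mem_tnth.
  (* No candidate realised by f0 contains both (w, false) and (w, true), so
     its entries fix f0 at t * s distinct pairs. *)
  have inj1 : {in sigma &, injective fst}.
    move=> p q pS qS eq1; rewrite [p]surjective_pairing [q]surjective_pairing.
    by rewrite -(f0E _ _ tau0 pS) -(f0E _ _ tau0 qS) eq1.
  pose D := setX [set u in tau] [set w in map fst sigma].
  have card_D : #|D| = t * s.
    rewrite cardsX !cardsE (card_uniqP Utau) size_tuple; congr (_ * _).
    by rewrite (card_uniqP _) ?map_inj_in_uniq // size_map size_tuple.
  have -> : bad (tau, sigma) =
      [set f : {ffun _} | [forall x in D, f x == f0 x]].
    apply/setP => f; rewrite !inE /=; apply/forall_inP/forall_inP.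
      move=> fE [u w]; rewrite !inE /= => /andP[uT /mapP[p pS ->]].
      by have /forall_inP/(_ p pS)/eqP-> := fE u uT; rewrite f0E.
    move=> fE u uT; apply/forall_inP => p pS.
    have/fE/eqP-> : (u, p.1) \in D by rewrite !inE /= uT map_f.
    by rewrite f0E.
  rewrite card_ffun_agree card_bool -expnD -card_D addnC cardsC.
  by rewrite card_prod.
have [f nbad] : exists f, f \notin \bigcup_(c | proper c) bad c.
  apply/existsP; rewrite -negb_forall; apply/negP => /forallP cover.
  have : #|{ffun K * W -> bool}| <= \sum_(c | proper c) #|bad c|.
    rewrite -cardsT; have -> : [set: {ffun K * W -> bool}]
        = \bigcup_(c | proper c) bad c.
      by apply/esym/eqP; rewrite -subTset; apply/subsetP.
    elim/big_ind2: _ => [|m A n B mA nB|//]; first by rewrite cards0.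
    by apply: leq_trans (leq_card_setU _ _) _; apply: leq_add.
  rewrite card_ffun card_bool card_prod leqNgt => /negP; apply.
  rewrite -(ltn_pmul2r (expn_gt0 2 (t * s))) big_distrl /=.
  apply: leq_ltn_trans (_ : #|cand| * 2 ^ (#|K| * #|W|) < _).
    rewrite -sum_nat_const [leqRHS](bigID proper) /=.
    by apply: leq_trans (leq_addr _ _); apply: leq_sum => c /card_bad.
  rewrite mulnC ltn_pmul2l ?expn_gt0 // card_prod !card_tuple card_prod.
  by rewrite card_bool [#|W| * 2]mulnC.
exists f => T S /card_geqP[tau [Utau /eqP stau sub1]].
move=> /card_geqP[sigma [Us /eqP ss sub2]].
have : f \notin bad (Tuple stau, Tuple ss).
  by apply: contra nbad => fb; apply/bigcupP; eexists; last exact: fb; exact/andP.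
rewrite inE negb_forall_in => /exists_inP[u uT].
rewrite negb_forall_in => /exists_inP[p pS neq].
by exists u, p; split=> //; [exact: sub1|exact: sub2].
Qed.

(** * Tilings and sets with few neighbours *)

Section TilingBound.
Variables (G : sgraph) (A B : {set G}) (s t : nat).
Hypothesis disjAB : [disjoint A & B].
Hypothesis nbrsA : forall x y, x \in A -> edge x y -> y \in B.
Hypothesis free : forall T S : {set G},
  T \subset A -> S \subset B -> t <= #|T| -> s <= #|S| ->
  exists x y, [/\ x \in T, y \in S & ~~ edge x y].

(** If the copy meets [A] at the image of [x], the [s] vertices opposite to [x]
    go to [B]; all vertices sent to [A] are then on the side of [x], where they
    form a biclique with those [s] vertices, so there are fewer than [t]. *)
Lemma copy_bound (f : 'K_(s, s) -> G) : is_copy f ->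
  s * #|f @^-1: A| <= t.-1 * #|f @^-1: B|.
Proof.
move=> [f_inj f_homo].
have [->|[x xA]] := set_0Vmem (f @^-1: A); first by rewrite cards0 muln0.
pose N : {set 'K_(s, s)} := [set y | edge x y].
have card_N : #|N| = s.
  rewrite -[RHS]card_ord /N; case: (x) => i.
    rewrite -(card_imset predT (@inr_inj 'I_s 'I_s)); apply: eq_card => -[] j.
      by rewrite inE; apply/esym/negP => /imsetP[].
    by rewrite inE; apply/esym/imsetP; exists j.
  rewrite -(card_imset predT (@inl_inj 'I_s 'I_s)); apply: eq_card => -[] j.
    by rewrite inE; apply/esym/imsetP; exists j.
  by rewrite inE; apply/esym/negP => /imsetP[].
have N_B : N \subset f @^-1: B.
  apply/subsetP => y; rewrite !inE => /f_homo; apply: nbrsA.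
  by rewrite inE in xA.
have far y z : y \notin N -> z \in N -> edge y z.
  by rewrite !inE; case: (x) (y) (z) => ? [] ? [] ?.
have A_N y : y \in f @^-1: A -> y \notin N.
  rewrite inE => yA; apply: contraL yA => /(subsetP N_B); rewrite inE => yB.
  by rewrite (disjointFl disjAB).
rewrite mulnC; apply: leq_mul; last by rewrite -{1}card_N subset_leq_card.
rewrite -ltnS; case: (ltnP #|f @^-1: A| t) => [/ltn_predK->//|t_le].
have [||||u [v [/imsetP[y yA ->] /imsetP[z zN ->]]]] :=
  free (T := f @: (f @^-1: A)) (S := f @: N).
- by apply/subsetP => _ /imsetP[y + ->]; rewrite inE.
- by apply/subsetP => _ /imsetP[y /(subsetP N_B) + ->]; rewrite inE.
- by rewrite card_imset.
- by rewrite card_imset // card_N.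
by rewrite f_homo // far // A_N.
Qed.

(** Summing [copy_bound] over a tiling gives the bound for the whole graph,
    because the disjoint copies cover every vertex by a cardinality count. *)
Lemma tiling_bound : can_be_tiled G s -> s * #|A| <= t.-1 * #|B|.
Proof.
move=> [m [cardG [f [f_copy f_disj]]]].
pose C i := f i @: [set: 'K_(s, s)].
have C_disj i j : i != j -> [disjoint C i & C j].
  move=> /f_disj; rewrite !disjoint_subset => /subsetP dis.
  apply/subsetP => _ /imsetP[x _ ->].
  have := dis _ (codom_f (f i) x); apply: contra => /imsetP[y _ ->].
  exact: codom_f.
have sumC (E : G -> nat) : \sum_(i < m) \sum_(x in C i) E x =
    \sum_(x in \bigcup_(i < m) C i) E x.
  by rewrite partition_disjoint_bigcup.
have C_cover : \bigcup_(i < m) C i = [set: G].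
  apply/eqP; rewrite eqEcard subsetT cardsT cardG -sum1_card -sumC.
  rewrite (eq_bigr (fun=> s + s)) ?sum_nat_const ?card_ord; first by lia.
  move=> i _; rewrite sum1_card card_imset; last by case: (f_copy i).
  by rewrite cardsT card_sum card_ord.
have cardE (X : {set G}) : #|X| = \sum_(i < m) #|f i @^-1: X|.
  transitivity (\sum_(x in \bigcup_(i < m) C i) (x \in X : nat)).
    rewrite C_cover -sum1_card [LHS]big_mkcond.
    by apply: eq_big => x; rewrite ?inE //; case: ifP.
  rewrite -sumC; apply: eq_bigr => i _.
  rewrite big_imset /=; last by move=> ? ? _ _; case: (f_copy i) => + _; apply.
  rewrite -sum1_card [RHS]big_mkcond.
  by apply: eq_big => x; rewrite ?inE //; case: ifP.
by rewrite !cardE !big_distrr leq_sum // => i _; apply: copy_bound.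
Qed.

End TilingBound.

(** * The extremal graph *)

Lemma leq_min_deg (G : sgraph) (A : {set G}) (c : nat) :
  c <= #|G| -> {in A, forall x, c <= deg x} -> c <= min_deg A.
Proof.
move=> cG cA; rewrite /min_deg; elim/big_ind: _ => // m1 m2.
by rewrite leq_min => -> ->.
Qed.

Section BipartiteGraph.
Variables (A B : finType) (e : A -> B -> bool).

Definition bip_edge : rel (A + B)%type := fun x y =>
  match x, y with
  | inl a, inr b | inr b, inl a => e a b
  | _, _ => false
  end.

Lemma bip_edge_sym : symmetric bip_edge. Proof. by case=> ? []. Qed.

Lemma bip_edge_irrefl : irreflexive bip_edge. Proof. by case. Qed.

Definition bip_graph : sgraph := SGraph bip_edge_sym bip_edge_irrefl.

Definition left_class : {set bip_graph} := [set inl a | a : A].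
Definition right_class : {set bip_graph} := [set inr b | b : B].

Lemma bip_graphP : bipartition left_class right_class.
Proof.
split.
- apply/setP => -[x|x]; rewrite !inE.
    by rewrite imset_f.
  by rewrite imset_f // orbT.
- rewrite disjoint_subset; apply/subsetP => _ /imsetP[a _ ->].
  by apply/imsetP => -[].
- by move=> _ _ /imsetP[a _ ->] /imsetP[b _ ->].
- by move=> _ _ /imsetP[a _ ->] /imsetP[b _ ->].
Qed.

Lemma card_left_class : #|left_class| = #|A|.
Proof. by rewrite card_imset //; apply: inl_inj. Qed.

Lemma card_right_class : #|right_class| = #|B|.
Proof. by rewrite card_imset //; apply: inr_inj. Qed.

Lemma deg_left a : deg (inl a : bip_graph) = #|[set b | e a b]|.
Proof.
rewrite /deg -(card_imset _ (@inr_inj A B)); apply: eq_card => -[x|x].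
  by rewrite inE; apply/esym/negP => /imsetP[].
by rewrite mem_imset ?inE //; apply: inr_inj.
Qed.

Lemma deg_right b : deg (inr b : bip_graph) = #|[set a | e a b]|.
Proof.
rewrite /deg -(card_imset _ (@inl_inj A B)); apply: eq_card => -[x|x].
  by rewrite mem_imset ?inE //; apply: inl_inj.
by rewrite inE; apply/esym/negP => /imsetP[].
Qed.

End BipartiteGraph.

Section PaddedGraph.
Variables (K W : finType) (f : {ffun K * W -> bool}) (p q : nat).

(** The vertices of ['I_p] have full degree: they keep the degrees on the right
    at least [p]. Those of ['I_q] only bring the right class to the size of the
    left one. *)
Definition padded_adj (x : K + 'I_p) (y : W * bool + 'I_q) : bool :=
  match x, y with
  | inl u, inl v => f (u, v.1) == v.2
  | inl _, inr _ => false
  | inr _, _ => true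
  end.

Definition padded_graph : sgraph := bip_graph padded_adj.

Lemma min_deg_left :
  #|W| <= min_deg (left_class padded_adj : {set padded_graph}).
Proof.
apply: leq_min_deg => [|_ /imsetP[[u|i] _ ->]].
- by rewrite !card_sum card_prod card_bool; lia.
- rewrite deg_left.
  pose g (w : W) : W * bool + 'I_q := inl (w, f (u, w)).
  rewrite -(card_imset _ (_ : injective g)); last by move=> w1 w2 [].
  by apply/subset_leq_card/subsetP => _ /imsetP[w _ ->]; rewrite inE /=.
- rewrite deg_left (_ : [set b | _] = setT); last first.
    by apply/setP => b; rewrite !inE.
  by rewrite cardsT card_sum card_prod card_bool; lia.
Qed.

Lemma min_deg_right :
  p <= min_deg (right_class padded_adj : {set padded_graph}).
Proof.
apply: leq_min_deg => [|_ /imsetP[v _ ->]].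
  by rewrite !card_sum card_ord; lia.
rewrite deg_right -[leqLHS]card_ord -(card_imset _ (@inr_inj K 'I_p)).
by apply/subset_leq_card/subsetP => _ /imsetP[i _ ->]; rewrite inE.
Qed.

Lemma padded_graph_tiling_bound s t :
    (forall (T : {set K}) (S : {set W * bool}), t <= #|T| -> s <= #|S| ->
      exists u v, [/\ u \in T, v \in S & f (u, v.1) != v.2]) ->
  can_be_tiled padded_graph s -> s * #|K| <= t.-1 * (2 * #|W|).
Proof.
move=> free.
pose gl (u : K) : padded_graph := inl (inl u).
pose gr (v : W * bool) : padded_graph := inr (inl v).
have gl_inj : injective gl by move=> ? ? [].
have gr_inj : injective gr by move=> ? ? [].
have pre (X : finType) (g : X -> padded_graph) (S : {set padded_graph}) :
    S \subset [set g x | x : X] -> #|S| <= #|g @^-1: S|.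
  move=> Sg; apply: leq_trans (leq_imset_card g _).
  apply/subset_leq_card/subsetP => y yS.
  have /imsetP[x _ yE] := subsetP Sg y yS.
  by rewrite yE imset_f // inE -yE.
have := @tiling_bound padded_graph [set gl u | u : K]
  [set gr v | v : W * bool] s t.
rewrite !card_imset // card_prod card_bool [#|W| * 2]mulnC; apply.
- rewrite disjoint_subset; apply/subsetP => _ /imsetP[u _ ->].
  by apply/imsetP => -[].
- move=> _ y /imsetP[u _ ->]; case: y => [//|[v _|//]]; exact: imset_f.
move=> T S Tl Sr tT sS.
have [||u [v [uT vS neq]]] := free (gl @^-1: T) (gr @^-1: S).
- exact: leq_trans tT (pre _ _ _ Tl).
- exact: leq_trans sS (pre _ _ _ Sr).
by rewrite !inE in uT vS; exists (gl u), (gr v).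
Qed.

End PaddedGraph.

(** * Growth estimate and conclusion *)

Import Order.TTheory GRing.Theory Num.Theory.
Local Open Scope ring_scope.

Lemma ln2_ge_half (R : realType) : 1 / 2 <= ln (2 : R).
Proof.
have := @le_ln1Dx R (- (1 / 2)) ltac:(lra).
have -> : 1 + - (1 / 2) = 2^-1 :> R by lra.
rewrite lnV ?posrE //; lra.
Qed.

(** Put [x = s ^ (1/3)]. The logarithm of the left side is
    [x ln s = 3 x ln x <= 3 x ^ 2], and that of the right side is at least
    [(s - 7) / 16 = (x ^ 3 - 7) / 16], which is larger once [x >= 64]. *)
Lemma powR_cbrt_le (R : realType) (s : nat) : (64 ^ 3 <= s)%N ->
  s%:R `^ (s%:R `^ (1 / 3)) <= (2 ^ (s %/ 8))%:R :> R.
Proof.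
move=> s_ge; set x : R := s%:R `^ (1 / 3).
have s_gt0 : 0 < s%:R :> R.
  by rewrite ltr0n; apply: leq_trans s_ge; rewrite expn_gt0.
have x_gt0 : 0 < x by rewrite powR_gt0.
have x3 : x ^+ 3 = s%:R.
  rewrite -powR_mulrn ?ltW // -powRrM (_ : 1 / 3 * 3 = 1); last lra.
  by rewrite powRr1 // ltW.
have x_ge : 64 <= x.
  rewrite -(@ler_pXn2r _ 3) ?nnegrE //; last exact: ltW.
  rewrite x3.
  have -> : 64 ^+ 3 = (64 ^ 3)%:R :> R by rewrite natrX.
  by rewrite ler_nat.
have ln_s : ln s%:R <= 3 * x.
  by rewrite -x3 lnXn // -[ln x *+ 3]mulr_natl ler_pM2l // ltW // ln_sublinear.
rewrite -ler_ln ?posrE ?powR_gt0 // ?natrX ?exprn_gt0 // ln_powR lnXn //.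
have a_ge : s%:R <= 8 * (s %/ 8)%:R + 7 :> R.
  rewrite -natrM -natrD ler_nat; lia.
have := ln2_ge_half R; rewrite -[ln 2 *+ _]mulr_natr.
set a : R := (s %/ 8)%:R in a_ge *; move=> ln2.
have a_ge0 : 0 <= a by rewrite ler0n.
have h1 : x * ln s%:R <= x * (3 * x) by rewrite ler_pM2l.
have h2 : (1 / 2) * a <= ln 2 * a by rewrite ler_wpM2r.
have h3 : 64 * (x * x) <= x ^+ 3.
  by rewrite exprS expr2 ler_wpM2r // mulr_ge0 // ltW.
have h4 : 64 * 64 <= x * x by apply: ler_pM.
rewrite -x3 in a_ge; lra.
Qed.

Theorem proposition1p12 (R : realType) :
  exists s0 n0 : nat, forall s : nat, (s0 <= s)%N ->
  exists n : nat, [/\ (n0 <= n)%N, (s %| n)%N &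
  exists (G : sgraph) (U V : {set G}),
    [/\ bipartition U V, balanced U V, #|G| = (2 * n)%N,
        n%:R + s%:R `^ (s%:R `^ (1 / 3)) <= (min_deg U + min_deg V)%:R :> R &
        ~ can_be_tiled G s]].
Proof.
exists (64 ^ 3)%N, 0%N => s s_ge.
have {}/(powR_cbrt_le R) s_big := s_ge.
have s_ge24 : (24 <= s)%N by apply: leq_trans s_ge.
set a := (s %/ 8)%N in s_big.
have a_ge3 : (3 <= a)%N by rewrite leq_divRL.
have s_ge8a : (8 * a <= s)%N by rewrite mulnC leq_trunc_div.
set k := (2 ^ a)%N in s_big.
have k_gt0 : (0 < k)%N by rewrite expn_gt0.
have [f free] : exists f : {ffun 'I_k * 'I_(2 * k) -> bool},
    forall (T : {set 'I_k}) (S : {set 'I_(2 * k) * bool}),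
      (2 * a <= #|T|)%N -> (s <= #|S|)%N ->
      exists u v, [/\ u \in T, v \in S & f (u, v.1) != v.2].
  apply: exists_biclique_free_halving; first lia.
  rewrite !card_ord mulnA -[(2 * 2)%N]/(2 ^ 2)%N -expnD -!expnM -expnD.
  (* From 8 * a <= s the inequality reduces to 2 * a < 8 * (a - 2). *)
  rewrite ltn_exp2l //; nia.
(* The factor 4 * k makes room for V0. *)
pose n := (s * (4 * k))%N.
have n_ge : (4 * k <= n)%N by rewrite /n; nia.
exists n; split=> //; first exact: dvdn_mulr.
exists (padded_graph f (n - k) (n - 4 * k)), (left_class _), (right_class _).
split.
- exact: bip_graphP.
- rewrite /balanced card_left_class card_right_class !card_sum card_prod.
  rewrite card_bool !card_ord; lia.
- rewrite !card_sum card_prod card_bool !card_ord; lia.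
- apply: le_trans (_ : (n + k)%:R <= _); first by rewrite natrD lerD2l.
  rewrite ler_nat; have := min_deg_right f (n - k) (n - 4 * k).
  have := min_deg_left f (n - k) (n - 4 * k); rewrite card_ord; lia.
move=> /(padded_graph_tiling_bound free); rewrite !card_ord; nia.
Qed.
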